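(* Let $\theta>0$ and $n\ge1$. Under the Ewens-like distribution for records with parameter $\theta$ on $\mathfrak{S}_n$, for every $k\in[n]$, $$\mathbb{P}_n(\sigma(1)=k)=\frac{(n-1)!\,\theta^{(n-k)}\,\theta}{(n-k)!\,\theta^{(n)}}.$$
   Context: $\mathfrak{S}_n$ is the set of permutations of $[n]=\{1,\dots,n\}$. A permutation $\sigma$ has a record at position $i$ if $\sigma(i)>\sigma(j)$ for all $j<i$; $\mathrm{rec}(\sigma)$ is the number of records. The Ewens-like distribution for records with parameter $\theta>0$ gives each $\sigma\in\mathfrak{S}_n$ probability proportional to $\theta^{\mathrm{rec}(\sigma)}$; $\mathbb{P}_n$ denotes probability under it. The rising factorial is $x^{(m)}=x(x+1)\cdots(x+m-1)$, $x^{(0)}=1$. *)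

(* Defs.v *)
From HB Require Import structures.
From mathcomp Require Import all_boot all_order all_fingroup all_algebra.

Set Implicit Arguments.
Unset Strict Implicit.
Unset Printing Implicit Defensive.

Import Order.TTheory GRing.Theory Num.Theory.
Local Open Scope ring_scope.

(* The ordinal i : 'I_n stands for the integer i + 1 of {1, ..., n}, both as a
   position and as a value; as records depend only on the order of positions
   and values, no shift is needed here. *)

Definition is_record (n : nat) (s : 'S_n) (i : 'I_n) : bool :=
  [forall j : 'I_n, (j < i)%N ==> (s j < s i)%N].

Definition nb_records (n : nat) (s : 'S_n) : nat :=
  #|[set i : 'I_n | is_record s i]|.

Definition ewens_rec_pmf (R : realFieldType) (theta : R) (n : nat) (s : 'S_n)
    : R :=
  theta ^+ nb_records s / \sum_(t : 'S_n) theta ^+ nb_records t.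

Definition ewens_rec_prob (R : realFieldType) (theta : R) (n : nat)
    (A : {set 'S_n}) : R :=
  \sum_(s in A) ewens_rec_pmf theta s.

Definition rising (R : realFieldType) (x : R) (m : nat) : R :=
  \prod_(0 <= i < m) (x + i%:R).

Lemma ewens_rec_pmf_ge0 (R : realFieldType) (theta : R) (n : nat) (s : 'S_n) :
  0 < theta -> 0 <= ewens_rec_pmf theta s.
Proof.
move=> theta0; apply: divr_ge0; first exact/exprn_ge0/ltW.
by apply: sumr_ge0 => t _; exact/exprn_ge0/ltW.
Qed.

Lemma ewens_rec_probT (R : realFieldType) (theta : R) (n : nat) :
  0 < theta -> ewens_rec_prob theta [set: 'S_n] = 1.
Proof.
move=> theta0; rewrite /ewens_rec_prob (eq_bigl xpredT) => [|s]; last by rewrite inE.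
rewrite /ewens_rec_pmf -mulr_suml.
rewrite divff // gt_eqF // (bigD1 (1%g : 'S_n)) //= ltr_pwDl ?exprn_gt0 //.
by apply: sumr_ge0 => t _; exact/exprn_ge0/ltW.
Qed.

(* Main.v *)
(* Delete the value 1 from a permutation of [n+1].  Records keep their status,
   except that the position of the value 1 is a record iff it is the first
   one.  Hence the partition function satisfies Z_(n+1) = (theta + n) Z_n, and
   the total weight W_(n+1)(k) of the permutations with sigma(1) = k satisfies
   W_(n+1)(1) = theta Z_n and W_(n+1)(k+1) = n W_n(k), since the value 1 can then
   be re-inserted at any of the n positions other than the first. *)
Require Import Defs.
From HB Require Import structures.
From mathcomp Require Import all_boot all_order all_fingroup all_algebra.

Set Implicit Arguments.
Unset Strict Implicit.
Unset Printing Implicit Defensive.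

Import Order.TTheory GRing.Theory Num.Theory.
Local Open Scope ring_scope.

(** [lift_perm i ord0 t] is [t] with a new least value inserted at position [i]. Since [lift]
    preserves order, comparisons between old positions are unchanged, and the new value never blocks
    a later record. *)
Lemma nb_records_lift_perm n (i : 'I_n.+1) (t : 'S_n) :
  nb_records (lift_perm i ord0 t) = ((i == ord0) + nb_records t)%N.
Proof.
have rec_lift (j : 'I_n) :
    is_record (lift_perm i ord0 t) (lift i j) = is_record t j.
  have ltn_lift (h : 'I_n.+1) (a b : 'I_n) : (lift h a < lift h b)%N = (a < b)%N.
    by rewrite !ltnNge leq_bump2.
  apply/forallP/forallP => [rec_s j' | rec_t i'].
    by have := rec_s (lift i j'); rewrite !lift_perm_lift !ltn_lift.
  case: (unliftP i i') => [j'|] ->.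
    by rewrite !lift_perm_lift !ltn_lift.
  by rewrite lift_perm_id lift_perm_lift implybT.
have rec_i : is_record (lift_perm i ord0 t) i = (i == ord0).
  apply/forallP/eqP => [rec_s | -> //].
  apply/val_inj/eqP; rewrite /= -leqn0 leqNgt.
  by apply: contraL (rec_s ord0) => i_gt0; rewrite lift_perm_id /= i_gt0.
rewrite /nb_records -!sum1dep_card [LHS]big_mkcond [in RHS]big_mkcond /=
  (bigD1_ord i) //= rec_i.
by congr (_ + _)%N; apply: eq_bigr => j _; rewrite rec_lift.
Qed.

(** Insertion of the least value is a bijection: it is injective, and both sides have [(n.+1)!]
    elements. *)
Lemma sum_lift_perm (V : nmodType) n (P : pred 'S_n.+1) (F : 'S_n.+1 -> V) :
  \sum_(s | P s) F s
  = \sum_(i < n.+1) \sum_(t : 'S_n | P (lift_perm i ord0 t))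
      F (lift_perm i ord0 t).
Proof.
rewrite pair_big_dep (reindex (fun p : 'I_n.+1 * 'S_n => lift_perm p.1 ord0 p.2)) //.
apply/onW_bij/inj_card_bij; last by rewrite card_prod card_ord !card_Sn factS.
move=> [i t] [j u] /= eq_st.
(* The insertion position is recovered as the preimage of [ord0]. *)
have eq_ij : i = j.
  by apply: (@perm_inj _ (lift_perm i ord0 t)); rewrite {2}eq_st !lift_perm_id.
rewrite -eq_ij in eq_st *; congr (_, _); apply/permP => l.
by apply: (@lift_inj _ ord0); rewrite -!(lift_perm_lift i) eq_st.
Qed.

Section RecordWeights.

Variables (R : realFieldType) (theta : R).

Definition total_weight n : R := \sum_(s : 'S_n) theta ^+ nb_records s.

(* W_(n+1)(v+1): both arguments are shifted by one. *)
Definition first_weight n v : R :=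
  \sum_(s : 'S_n.+1 | s ord0 == v :> nat) theta ^+ nb_records s.

Lemma total_weightS n :
  total_weight n.+1 = (theta + n%:R) * total_weight n.
Proof.
rewrite /total_weight sum_lift_perm big_ord_recl mulrDl mulr_sumr.
congr (_ + _).
  by apply: eq_bigr => t _; rewrite nb_records_lift_perm exprS.
under eq_bigr => i _ do
  under eq_bigr => t _ do rewrite nb_records_lift_perm eq_sym (negPf (neq_lift _ _)) add0n.
by rewrite sumr_const card_ord mulr_natl.
Qed.

Lemma total_weightE n : total_weight n = rising theta n.
Proof.
elim: n => [|n IHn]; last first.
  by rewrite total_weightS IHn /rising big_nat_recr //= mulrC.
have no_rec (s : 'S_0) : nb_records s = 0%N.
  by apply/eqP; rewrite cards_eq0; apply/eqP/setP => -[].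
rewrite /total_weight /rising big_geq //.
under eq_bigr => s _ do rewrite no_rec expr0.
by rewrite sumr_const card_Sn.
Qed.

Lemma first_weight0 n : first_weight n 0 = theta * total_weight n.
Proof.
rewrite /first_weight sum_lift_perm big_ord_recl [X in _ + X]big1 => [|i _].
  rewrite addr0 mulr_sumr; apply: eq_big => [t | t _]; first by rewrite lift_perm_id.
  by rewrite nb_records_lift_perm exprS.
(* The least value sits at [lift ord0 i], so by injectivity it cannot also come first. *)
apply: big_pred0 => t; apply: contraTF (neq_lift ord0 i) => /eqP t0.
rewrite negbK; apply/eqP/(@perm_inj _ (lift_perm (lift ord0 i) ord0 t)).
by rewrite lift_perm_id; apply: val_inj.
Qed.

Lemma first_weightS n v :
  first_weight n.+1 v.+1 = n.+1%:R * first_weight n v.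
Proof.
(* Insertion in first position makes the first value least, so that term is an empty sum. *)
rewrite /first_weight sum_lift_perm big_ord_recl big_pred0 => [|t]; last first.
  by rewrite lift_perm_id.
rewrite add0r.
transitivity (\sum_(i < n.+1) first_weight n v); last first.
  by rewrite sumr_const card_ord mulr_natl.
apply: eq_bigr => i _; apply: eq_big => [t | t _].
  suff -> : lift_perm (lift ord0 i) ord0 t ord0 = lift ord0 (t ord0) by [].
  (* The first position precedes the insertion point, hence equals [lift (lift ord0 i) ord0]. *)
  by rewrite -(lift_perm_lift (lift ord0 i)); congr (fun_of_perm _ _); apply: val_inj.
by rewrite nb_records_lift_perm.
Qed.

(** Division-free form, by induction on [v] with [n] varying: [n - v] is constant along the
    recursion, whose factors build up the factorial on the right. *)
Lemma first_weightE n v : (v <= n)%N ->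
  (n - v)`!%:R * first_weight n v = n`!%:R * rising theta (n - v) * theta.
Proof.
elim: v n => [|v IHv] [|n] // le_vn.
- by rewrite first_weight0 total_weightE mulrCA mulrC.
- by rewrite first_weight0 total_weightE subn0 mulrCA mulrC.
by rewrite first_weightS mulrCA subSS IHv // factS natrM !mulrA.
Qed.

End RecordWeights.

Theorem theorem3 (R : realFieldType) (theta : R) (theta_gt0 : 0 < theta)
    (n : nat) (n_gt0 : (1 <= n)%N) (k : nat) (k_range : (1 <= k <= n)%N) :
  ewens_rec_prob theta [set s : 'S_n | (s (Ordinal n_gt0)).+1 == k]
  = ((n - 1)`!%:R * rising theta (n - k) * theta)
    / ((n - k)`!%:R * rising theta n).
Proof.
case: n n_gt0 k_range => // n n_gt0; case: k => // k /andP[_]; rewrite ltnS => le_kn.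
have rising_neq0 m : rising theta m != 0.
  by rewrite gt_eqF // prodr_gt0 // => i _; rewrite ltr_wpDr.
have fact_neq0 m : m`!%:R != 0 :> R by rewrite pnatr_eq0 -lt0n fact_gt0.
rewrite /ewens_rec_prob /ewens_rec_pmf -mulr_suml -/(total_weight theta n.+1).
rewrite total_weightE !subSS subn0 -first_weightE //.
(* The factor [(n - k)!] now occurs above and below and cancels. *)
rewrite -mulf_div divff // mul1r; congr (_ / _); apply: eq_bigl => s.
by rewrite inE eqSS (_ : Ordinal n_gt0 = ord0) //; apply: val_inj.
Qed.
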